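(* Let $(V,\mathcal{S})$ be a set system with $V=\{1,\dots,n\}$ in which every element lies in at most $t\ge 1$ sets, let $a=6$, let $A_k\subseteq V$ be nonempty and let $x_{k-1}\in[-1,1]^n$. Let $\mathcal{B}_k=\{S\in\mathcal{S}: |S\cap A_k|\ge at\}$ and $\mathcal{L}_k=\mathcal{S}\setminus\mathcal{B}_k$. Then every feasible solution $(b,\alpha,\beta,\beta^x)$ of the program minimize $\sum_{i\in A_k}b_i$ subject to \[ \sum_{i\in A_k}b_ie_ie_i^T+\sum_{S\in\mathcal{B}_k}\alpha_Sv_Sv_S^T+\sum_{S\in\mathcal{L}_k}\left(\beta_S(v_Sv_S^T-2I_S)+\beta_S^x(x_Sx_S^T-2I_S)\right)\succeq I, \] $b_i\ge 0$ ($i\in A_k$), $\alpha_S\in\mathbb{R}$ ($S\in\mathcal{B}_k$), $\beta_S,\beta_S^x\ge 0$ ($S\in\mathcal{L}_k$), satisfies $\sum_{i\in A_k}b_i\ge |A_k|/3$; that is, this (dual) program has value at least $|A_k|/3$.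
   Context: All matrices are indexed by $A_k\times A_k$. $v_S\in\mathbb{R}^{A_k}$ is the indicator vector of $S\cap A_k$; $x_S\in\mathbb{R}^{A_k}$ has $i$-th entry $x_{k-1}(i)$ if $i\in S\cap A_k$ and $0$ otherwise; $I_S$ is diagonal with $(I_S)_{ii}=1$ iff $i\in S\cap A_k$; $I$ is the identity; $e_i$ are standard basis vectors; $A\succeq B$ means $A-B$ is positive semidefinite. This program is the dual of the semidefinite program: maximize $\sum_{i\in A_k}\|u_i\|_2^2$ over vectors $u_i$, subject to $\|\sum_{i\in S\cap A_k}u_i\|_2^2=0$ for $S\in\mathcal{B}_k$, $\|\sum_{i\in S\cap A_k}u_i\|_2^2\le 2\sum_{i\in S\cap A_k}\|u_i\|_2^2$ and $\|\sum_{i\in S\cap A_k}x_{k-1}(i)u_i\|_2^2\le 2\sum_{i\in S\cap A_k}\|u_i\|_2^2$ for $S\in\mathcal{L}_k$, and $\|u_i\|_2^2\le 1$ for $i\in A_k$. *)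

(* Defs.v *)
From HB Require Import structures.
From mathcomp Require Import all_boot all_order all_algebra.
From mathcomp Require Import classical_sets reals constructive_ereal ereal.

Set Implicit Arguments.
Unset Strict Implicit.
Unset Printing Implicit Defensive.

Import Order.TTheory GRing.Theory Num.Theory.
Local Open Scope ring_scope.

Definition psdmx (R : realType) (m : nat) (M : 'M[R]_m) : Prop :=
  M^T = M /\ forall u : 'cV[R]_m, 0 <= (u^T *m M *m u) 0 0.

Definition loewner_ge (R : realType) (m : nat) (M N : 'M[R]_m) : Prop :=
  psdmx (M - N).

Section SetSystem.
Variable n : nat.
Implicit Types (SS : {set {set 'I_n}}) (A S : {set 'I_n}).

Definition big_sets (a t : nat) SS A : {set {set 'I_n}} :=
  [set S in SS | (a * t <= #|S :&: A|)%N]%SET.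

Definition small_sets (a t : nat) SS A : {set {set 'I_n}} :=
  (SS :\: big_sets a t SS A)%SET.

End SetSystem.

(* Vectors and matrices over the index set A live in dimension #|A|; the
   coordinate j : 'I_#|A| stands for the element enum_val j of A. *)
Section DualProgram.
Variables (R : realType) (n : nat) (A : {set 'I_n}).
Implicit Types (S : {set 'I_n}) (x b : 'I_n -> R).

Definition unit_vec (i : 'I_n) : 'cV[R]_#|A| :=
  \col_j (enum_val j == i)%:R.

Definition indic_vec S : 'cV[R]_#|A| :=
  \col_j (enum_val j \in S)%:R.

Definition restr_vec x S : 'cV[R]_#|A| :=
  \col_j (if enum_val j \in S then x (enum_val j) else 0).

Definition diag_indic S : 'M[R]_#|A| :=
  diag_mx (\row_j (enum_val j \in S)%:R).

Definition dual_mx (B L : {set {set 'I_n}}) x b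
    (alpha beta betax : {set 'I_n} -> R) : 'M[R]_#|A| :=
  \sum_(i in A) b i *: (unit_vec i *m (unit_vec i)^T)
  + \sum_(S in B) alpha S *: (indic_vec S *m (indic_vec S)^T)
  + \sum_(S in L)
      (beta S *: (indic_vec S *m (indic_vec S)^T - 2%:R *: diag_indic S)
       + betax S *: (restr_vec x S *m (restr_vec x S)^T
                     - 2%:R *: diag_indic S)).

(* b, alpha, beta, betax are total functions, but only their values on A, B, L
   and L respectively enter the program. *)
Definition dual_feasible (B L : {set {set 'I_n}}) x b
    (alpha beta betax : {set 'I_n} -> R) : Prop :=
  [/\ loewner_ge (dual_mx B L x b alpha beta betax) 1%:M,
      forall i, i \in A -> 0 <= b i,
      forall S, S \in L -> 0 <= beta S
    & forall S, S \in L -> 0 <= betax S].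

Definition dual_objective b : R := \sum_(i in A) b i.

(* Infimum in the extended reals: +oo if the program is infeasible. *)
Definition dual_value (B L : {set {set 'I_n}}) x : \bar R :=
  ereal_inf [set y | exists b alpha beta betax,
    dual_feasible B L x b alpha beta betax /\ y = (dual_objective b)%:E]%classic.

End DualProgram.

(* Main.v *)
(* Let m = |A|, let G be the sum of the beta_S v_S v_S^T + betax_S x_S x_S^T, let
   g_j be the sum of beta_S + betax_S over the S in L containing j (so that
   G_jj <= g_j), and let F be the set of coordinates with b_j >= 1. On the
   subspace K of vectors vanishing on F and orthogonal to v_S for all S in B,
   feasibility reads u^T G u >= sum_j d_j u_j^2 with d_j = 2 g_j + 1 - b_j > 0
   off F. Summing over a d-orthonormal basis of K and applying Bessel's
   inequality to the rank one terms of G gives dim K <= sum_j g_j / d_j <= m / 2.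
   Since dim K >= m - |B| - |F|, and 6 |B| <= m by double counting incidences,
   m <= 3 |F| <= 3 sum_j b_j. *)

Require Import Defs.
From HB Require Import structures.
From mathcomp Require Import all_boot all_order all_algebra.
From mathcomp Require Import classical_sets reals constructive_ereal ereal.
From mathcomp Require Import ring lra zify.

Import Order.TTheory GRing.Theory Num.Theory.
Local Open Scope ring_scope.

(** * Orthonormal frames and Bessel's inequality for a diagonal weight *)

Lemma mulmx_diag_tr_entry (R : comPzRingType) (k l m : nat) (d : 'rV[R]_m)
    (P : 'M[R]_(k, m)) (Q : 'M[R]_(l, m)) i j :
  (P *m diag_mx d *m Q^T) i j = \sum_h P i h * d 0 h * Q j h.
Proof.
by rewrite mxE; apply: eq_bigr => h _; rewrite mul_mx_diag !mxE.
Qed.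

Lemma exists_unit_kernel_vector (R : rcfType) (m p : nat) (d : 'rV[R]_m)
    (C : 'M[R]_(m, p)) :
  (forall i, 0 < d 0 i) -> (p < m)%N ->
  exists u : 'rV[R]_m, u *m C = 0 /\ u *m diag_mx d *m u^T = 1%:M.
Proof.
move=> d_gt0 ltpm.
have /rowV0Pn[v /sub_kermxP vC v_neq0] : kermx C != 0.
  by rewrite -mxrank_eq0 mxrank_ker subn_eq0 -ltnNge (leq_ltn_trans (rank_leq_col C)).
pose s := \sum_h v 0 h * d 0 h * v 0 h.
have term_ge0 h : 0 <= v 0 h * d 0 h * v 0 h.
  by rewrite mulrAC mulr_ge0 ?(ltW (d_gt0 h)) // -expr2 sqr_ge0.
have s_gt0 : 0 < s.
  rewrite lt_neqAle sumr_ge0 // andbT eq_sym; apply: contra v_neq0 => s0.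
  apply/eqP/rowP => h; rewrite mxE; apply/eqP.
  move: s0; rewrite psumr_eq0 // => /allP/(_ h); rewrite mem_index_enum => /(_ isT) /=.
  by rewrite !mulf_eq0 (gt_eqF (d_gt0 h)) orbF orbb.
exists ((Num.sqrt s)^-1 *: v); split; first by rewrite -scalemxAl vC scaler0.
apply/matrixP => i j; rewrite !ord1 mulmx_diag_tr_entry !mxE eqxx /=.
rewrite (_ : \sum_h _ = (Num.sqrt s) ^- 2 * s); last first.
  by rewrite mulr_sumr; apply: eq_bigr => h _; rewrite !mxE -exprVn; ring.
by rewrite sqr_sqrtr ?(ltW s_gt0) // mulVf ?gt_eqF.
Qed.

(** Gram-Schmidt without projections: orthogonality to the rows already found is one more kernel
    condition, so the next row is a unit vector in the left kernel of [C] augmented by the columns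
    of [diag_mx d *m Q^T]. There are [p + k] columns, fewer than [m] as long as a row is missing. *)
Lemma exists_orthonormal_kernel_frame (R : rcfType) (m p k : nat)
    (d : 'rV[R]_m) (C : 'M[R]_(m, p)) :
  (forall i, 0 < d 0 i) -> (p + k <= m)%N ->
  exists Q : 'M[R]_(k, m), Q *m C = 0 /\ Q *m diag_mx d *m Q^T = 1%:M.
Proof.
move=> d_gt0; elim: k => [|k IHk] lepk.
  by exists 0; split; [rewrite mul0mx | apply/matrixP=> -[]].
have [|Q [QC QQ]] := IHk; first by rewrite (leq_trans _ lepk) // leq_add2l.
have [|u [uC uu]] := @exists_unit_kernel_vector R m (p + k) d
  (row_mx C (diag_mx d *m Q^T)) d_gt0; first by rewrite -addnS.
move: uC; rewrite mul_mx_row => /eqP; rewrite row_mx_eq0 => /andP[/eqP uC /eqP uQ].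
have Qu : Q *m diag_mx d *m u^T = 0.
  by apply: trmx_inj; rewrite !trmx_mul trmxK tr_diag_mx uQ trmx0.
rewrite -[k.+1]add1n; exists (col_mx u Q); split.
  by rewrite mul_col_mx uC QC col_mx0.
rewrite mul_col_mx tr_col_mx mul_col_row uu QQ Qu -mulmxA uQ.
by rewrite -scalar_mx_block.
Qed.

(** This is Bessel's inequality for the vector with entries [w i 0 / d 0 i] in the inner product
    weighted by [d]: its coefficients along the rows of [Q] are the entries of [Q *m w]. With [z]
    the vector [Q^T *m Q *m w], the two sides differ by the weighted squared norm of the
    residual. *)
Lemma bessel_diag (R : realFieldType) (m k : nat) (d : 'rV[R]_m)
    (Q : 'M[R]_(k, m)) (w : 'cV[R]_m) :
  (forall i, 0 < d 0 i) -> Q *m diag_mx d *m Q^T = 1%:M ->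
  \sum_j ((Q *m w) j 0) ^+ 2 <= \sum_i (w i 0) ^+ 2 / d 0 i.
Proof.
move=> d_gt0 QQ; pose c := Q *m w; pose z := Q^T *m c.
have -> : \sum_i (w i 0) ^+ 2 / d 0 i =
    \sum_i (w i 0 - d 0 i * z i 0) ^+ 2 / d 0 i
    + (2 * (\sum_i z i 0 * w i 0) - \sum_i z i 0 * d 0 i * z i 0).
  rewrite mulr_sumr -sumrB -big_split /=; apply: eq_bigr => i _.
  by field; rewrite gt_eqF.
have -> : \sum_i z i 0 * w i 0 = \sum_j (c j 0) ^+ 2.
  transitivity ((z^T *m w) 0 0).
    by rewrite mxE; apply: eq_bigr => i _; rewrite [in RHS]mxE.
  rewrite trmx_mul trmxK -mulmxA -/c mxE.
  by apply: eq_bigr => i _; rewrite mxE expr2.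
have -> : \sum_i z i 0 * d 0 i * z i 0 = \sum_j (c j 0) ^+ 2.
  transitivity ((z^T *m diag_mx d *m z^T^T) 0 0).
    by rewrite mulmx_diag_tr_entry; apply: eq_bigr => i _; rewrite !mxE.
  rewrite trmxK {2}/z trmx_mul trmxK !mulmxA -(mulmxA c^T) -(mulmxA c^T) QQ mulmx1.
  by rewrite -mulmxA -/c [LHS]mxE; apply: eq_bigr => i _; rewrite [c^T _ _]mxE expr2.
have : 0 <= \sum_i (w i 0 - d 0 i * z i 0) ^+ 2 / d 0 i.
  by apply: sumr_ge0 => i _; rewrite divr_ge0 ?sqr_ge0 ?ltW.
by rewrite -/c; lra.
Qed.

(** * The quadratic form of the dual matrix *)

Section QuadraticForm.
Variables (R : realType) (m : nat) (u : 'cV[R]_m).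

Definition qform (M : 'M[R]_m) : R := (u^T *m M *m u) 0 0.

Lemma qform_is_linear : scalar qform.
Proof.
move=> a M N; rewrite /qform mulmxDr mulmxDl -scalemxAr -scalemxAl.
by rewrite !mxE.
Qed.

HB.instance Definition _ :=
  GRing.isLinear.Build R 'M[R]_m R _ qform qform_is_linear.

Lemma qform_rank1 (w : 'cV[R]_m) : qform (w *m w^T) = ((u^T *m w) 0 0) ^+ 2.
Proof.
rewrite /qform mulmxA -(mulmxA (u^T *m w)) mxE big_ord1 expr2; congr (_ * _).
by rewrite -[w^T *m u]trmxK trmx_mul trmxK mxE.
Qed.

Lemma qform_diag (d : 'rV[R]_m) : qform (diag_mx d) = \sum_i d 0 i * u i 0 ^+ 2.
Proof.
rewrite /qform -{2}[u]trmxK mulmx_diag_tr_entry.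
by apply: eq_bigr => i _; rewrite !mxE; ring.
Qed.

End QuadraticForm.

Arguments qform {R m}.

Lemma sum_unit_vec_diag (R : realType) (n : nat) (A : {set 'I_n}) (b : 'I_n -> R) :
  \sum_(i in A) b i *: (unit_vec R A i *m (unit_vec R A i)^T)
  = diag_mx (\row_j b (enum_val j)).
Proof.
rewrite big_enum_val /=; apply/matrixP => k l; rewrite summxE !mxE.
rewrite (bigD1 k) //= big1 ?addr0 => [|j jk].
  by rewrite !mxE big_ord1 !mxE eqxx (inj_eq enum_val_inj) mul1r mulr_natr eq_sym.
by rewrite !mxE big_ord1 !mxE (inj_eq enum_val_inj) eq_sym (negPf jk) mul0r mulr0.
Qed.

Lemma qform_dual_mx (R : realType) (n : nat) (A : {set 'I_n})
    (B L : {set {set 'I_n}}) (x b : 'I_n -> R)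
    (alpha beta betax : {set 'I_n} -> R) (u : 'cV[R]_#|A|) :
  qform u (dual_mx A B L x b alpha beta betax) =
    \sum_(j < #|A|) (b (enum_val j)
            - 2 * \sum_(S in L) (beta S + betax S) * (enum_val j \in S)%:R)
           * u j 0 ^+ 2
    + \sum_(S in B) alpha S * ((u^T *m indic_vec R A S) 0 0) ^+ 2
    + \sum_(S in L) (beta S * ((u^T *m indic_vec R A S) 0 0) ^+ 2
                     + betax S * ((u^T *m restr_vec A x S) 0 0) ^+ 2).
Proof.
rewrite /dual_mx sum_unit_vec_diag 2!linearD /= !linear_sum /= qform_diag.
rewrite [X in _ + X + _](eq_bigr (fun S => alpha S * ((u^T *m indic_vec R A S) 0 0) ^+ 2));
  last by move=> S _; rewrite linearZ /= qform_rank1.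
(* The terms [-2 I_S] are split off set by set, so that exchanging the sums collects them coordinate
   by coordinate. *)
rewrite [X in _ + _ + X = _](eq_bigr (fun S =>
    (beta S * ((u^T *m indic_vec R A S) 0 0) ^+ 2
     + betax S * ((u^T *m restr_vec A x S) 0 0) ^+ 2)
    - \sum_(j < #|A|) 2 * ((beta S + betax S) * (enum_val j \in S)%:R) * u j 0 ^+ 2)); last first.
  move=> S _; rewrite linearD /= !linearZ /= !linearD /= !linearZ /= !linearN /=.
  rewrite !qform_rank1 /diag_indic qform_diag.
  have -> : \sum_(j < #|A|) 2 * ((beta S + betax S) * (enum_val j \in S)%:R) * u j 0 ^+ 2
    = 2 * (beta S + betax S)
      * \sum_i (\row_(j < #|A|) (enum_val j \in S)%:R) 0 i * u i 0 ^+ 2.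
    by rewrite mulr_sumr; apply: eq_bigr => j _; rewrite mxE; ring.
  by rewrite /GRing.scale /=; ring.
rewrite sumrB exchange_big /=.
rewrite [X in X + _ + _ = _](eq_bigr (fun j => b (enum_val j) * u j 0 ^+ 2));
  last by move=> j _; rewrite mxE.
rewrite [X in _ = X + _ + _](eq_bigr (fun j => b (enum_val j) * u j 0 ^+ 2
   - \sum_(S in L) 2 * ((beta S + betax S) * (enum_val j \in S)%:R) * u j 0 ^+ 2));
  last by move=> j _; rewrite mulrBl mulr_sumr mulr_suml.
by rewrite sumrB; ring.
Qed.

(** * Counting big sets, and the dimension bound *)

Lemma big_sets_card (n a t : nat) (SS : {set {set 'I_n}}) (A : {set 'I_n}) :
  (1 <= t)%N ->
  (forall i : 'I_n, (#|[set S in SS | i \in S]%SET| <= t)%N) ->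
  (a * #|big_sets a t SS A| <= #|A|)%N.
Proof.
(* After multiplication by [t], both sides are compared with the number of incidences between [A]
   and [SS]: a big set has at least [a * t] of them, an element of [A] at most [t]. *)
move=> t_gt0 deg_le; rewrite -(leq_pmul2r t_gt0).
apply: (@leq_trans (\sum_(S in SS) #|S :&: A|)%N).
  apply: (@leq_trans (\sum_(S in big_sets a t SS A) #|S :&: A|)%N).
    rewrite mulnAC mulnC -sum_nat_const; apply: leq_sum => S.
    by rewrite inE => /andP[].
  rewrite [leqRHS](big_setID (big_sets a t SS A)) /=.
  rewrite (_ : SS :&: _ = big_sets a t SS A)%SET ?leq_addr //.
  by apply/setP => S; rewrite !inE; case: (S \in SS).
rewrite (eq_bigr (fun S : {set 'I_n} => (\sum_(i in A) (i \in S : nat))%N)); last first.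
  move=> S _; rewrite -sum1_card big_mkcond /= [RHS]big_mkcond /=.
  by apply: eq_bigr => i _; rewrite !inE; case: (i \in S); case: (i \in A).
rewrite exchange_big /= -sum_nat_const; apply: leq_sum => i _.
apply: leq_trans (deg_le i); rewrite -sum1_card big_mkcond /= [leqRHS]big_mkcond /=.
by apply: leq_sum => S _; rewrite !inE; case: (S \in SS); case: (i \in S).
Qed.

Lemma dual_feasible_card (R : realType) (n : nat) (A : {set 'I_n})
    (B L : {set {set 'I_n}}) (x b : 'I_n -> R)
    (alpha beta betax : {set 'I_n} -> R) :
  (forall i : 'I_n, -1 <= x i <= 1) ->
  dual_feasible A B L x b alpha beta betax ->
  (#|A| <= 2 * (#|B| + #|[set j : 'I_#|A| | (1 <= b (enum_val j))%R]%SET|))%N.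
Proof.
move=> x_bound [[_ psd] b_ge0 beta_ge0 betax_ge0].
set F := [set _ | _]%SET; set p := (_ + _)%N.
pose g (j : 'I_#|A|) := \sum_(S in L) (beta S + betax S) * (enum_val j \in S)%:R.
(* On F the vectors considered vanish, so any positive value will do there. *)
pose h (j : 'I_#|A|) : R := if j \in F then 1 else 1 - b (enum_val j).
pose d : 'rV[R]_#|A| := \row_j (2 * g j + h j).
have g_ge0 j : 0 <= g j.
  by apply: sumr_ge0 => S SL; rewrite mulr_ge0 // addr_ge0 ?beta_ge0 ?betax_ge0.
have h_gt0 j : 0 < h j.
  by rewrite /h inE; case: (leP 1 (b _)) => bj; rewrite ?ltr01 ?subr_gt0.
have d_gt0 j : 0 < d 0 j by rewrite mxE ltr_wpDl ?mulr_ge0.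
(* The columns are the [v_S] for [S] in [B] and the basis vectors of [F], so the left kernel of [C]
   is the subspace K. *)
pose C : 'M[R]_(#|A|, #|B| + #|F|) :=
  row_mx (\matrix_(i, j) indic_vec R A (enum_val j) i 0)
         (\matrix_(i, j) (i == enum_val j)%:R).
have [lemp|/ltnW ltpm] := leqP #|A| p; first by lia.
have [|Q [QC QQ]] := @exists_orthonormal_kernel_frame R #|A| p (#|A| - p) d C d_gt0.
  by rewrite subnKC.
move: QC; rewrite mul_mx_row => /eqP; rewrite row_mx_eq0 => /andP[/eqP QB /eqP QF].
have QB0 k S : S \in B -> (Q *m indic_vec R A S) k 0 = 0.
  move=> SB; have /matrixP/(_ k (enum_rank_in SB S)) := QB.
  rewrite !mxE => E; rewrite -[RHS]E.
  by apply: eq_bigr => i _; rewrite !mxE enum_rankK_in.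
have QF0 k j : j \in F -> Q k j = 0.
  move=> jF; have /matrixP/(_ k (enum_rank_in jF j)) := QF.
  rewrite !mxE (bigD1 j) //= big1 => [|i ij].
    by rewrite mxE enum_rankK_in // eqxx mulr1 addr0.
  by rewrite mxE enum_rankK_in // (negPf ij) mulr0.
have rowE k (w : 'cV[R]_#|A|) : ((row k Q)^T^T *m w) 0 0 = (Q *m w) k 0.
  by rewrite trmxK -row_mul mxE.
(* Feasibility is tested on row [k] of [Q]. The [alpha] terms vanish whatever their sign, and the
   diagonal terms, including the identity, add up to minus the weighted squared norm of the row,
   which is -1. *)
have row_bound k : 1 <= \sum_(S in L) (beta S * ((Q *m indic_vec R A S) k 0) ^+ 2
                     + betax S * ((Q *m restr_vec A x S) k 0) ^+ 2).
  have := psd (row k Q)^T; rewrite -/(qform _ _) linearB /= qform_dual_mx.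
  rewrite -diag_const_mx qform_diag.
  rewrite [X in _ + X + _]big1 => [|S SB]; last first.
    by rewrite rowE QB0 // expr0n mulr0.
  rewrite [X in _ + X - _](eq_bigr (fun S => beta S * ((Q *m indic_vec R A S) k 0) ^+ 2
                     + betax S * ((Q *m restr_vec A x S) k 0) ^+ 2)); last first.
    by move=> S _; rewrite !rowE.
  have /matrixP/(_ k k) := QQ; rewrite mulmx_diag_tr_entry !mxE eqxx /= => QQk.
  set X := \sum_(S in L) _; rewrite addr0 addrAC -sumrB.
  under eq_bigr => j _.
    rewrite (_ : _ - _ = - (Q k j * d 0 j * Q k j)); first by over.
    rewrite !mxE /h -/(g j); case: (boolP (j \in F)) => [jF|_]; last by ring.
    by rewrite QF0 //; ring.
  by rewrite sumrN QQk addrC subr_ge0.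
have sumk : (#|A| - p)%:R <= \sum_(S in L) (beta S * \sum_k ((Q *m indic_vec R A S) k 0) ^+ 2
                     + betax S * \sum_k ((Q *m restr_vec A x S) k 0) ^+ 2).
  rewrite (eq_bigr (fun S => \sum_k (beta S * ((Q *m indic_vec R A S) k 0) ^+ 2
                     + betax S * ((Q *m restr_vec A x S) k 0) ^+ 2))); last first.
    by move=> S _; rewrite big_split /= -!mulr_sumr.
  rewrite exchange_big /= -[X in X%:R]card_ord -sum1_card natr_sum.
  exact: ler_sum.
have indic_bound S i : (indic_vec R A S i 0) ^+ 2 <= (enum_val i \in S)%:R.
  by rewrite mxE; case: (_ \in S); rewrite ?expr1n ?expr0n.
have restr_bound S i : (restr_vec A x S i 0) ^+ 2 <= (enum_val i \in S)%:R.
  rewrite mxE; case: (_ \in S); last by rewrite expr0n.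
  by have /andP[? ?] := x_bound (enum_val i); rewrite mulr1n; nra.
(* Once the right side is regrouped by sets, Bessel applies to each [v_S] and [x_S], whose squared
   entries are at most the indicator of [S]. *)
have trace_bound : \sum_(S in L) (beta S * \sum_k ((Q *m indic_vec R A S) k 0) ^+ 2
       + betax S * \sum_k ((Q *m restr_vec A x S) k 0) ^+ 2)
    <= \sum_j g j / d 0 j.
  under [leRHS]eq_bigr do rewrite mulr_suml.
  rewrite exchange_big /=; apply: ler_sum => S SL.
  under [leRHS]eq_bigr do rewrite mulrDl mulrDl -!mulrA.
  rewrite big_split /= -!mulr_sumr.
  apply: lerD; apply: ler_wpM2l; rewrite ?beta_ge0 ?betax_ge0 //;
    apply: le_trans (bessel_diag _ _ _ _ _ _ d_gt0 QQ) _;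
    by apply: ler_sum => i _; rewrite ler_pM2r ?invr_gt0.
(* Each quotient is at most 1/2, since [d 0 j] exceeds [2 * g j] by [h j > 0]. *)
have half_bound : \sum_j g j / d 0 j <= #|A|%:R / 2.
  have -> : #|A|%:R / 2 = \sum_(j < #|A|) 2^-1 :> R.
    by rewrite sumr_const card_ord mulrC mulr_natr.
  apply: ler_sum => j _.
  rewrite ler_pdivrMr // mxE; have := g_ge0 j; have := h_gt0 j; lra.
have : (2 * (#|A| - p))%:R <= #|A|%:R :> R by rewrite natrM; lra.
by rewrite ler_nat; lia.
Qed.

Theorem theorem5 (R : realType) (n t : nat) (SS : {set {set 'I_n}})
    (A : {set 'I_n}) (x : 'I_n -> R)
    (t_ge1 : (1 <= t)%N)
    (deg_le_t : forall i : 'I_n, (#|[set S in SS | i \in S]%SET| <= t)%N)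
    (A_neq0 : A != finset.set0)
    (x_bound : forall i : 'I_n, -1 <= x i <= 1) :
  let B := big_sets 6 t SS A in
  let L := small_sets 6 t SS A in
  (forall (b : 'I_n -> R) (alpha beta betax : {set 'I_n} -> R),
     dual_feasible A B L x b alpha beta betax ->
     #|A|%:R / 3%:R <= dual_objective A b)
  /\ ((#|A|%:R / 3%:R)%:E <= dual_value A B L x)%E.
Proof.
move=> B L.
have bound b alpha beta betax : dual_feasible A B L x b alpha beta betax ->
    #|A|%:R / 3%:R <= dual_objective A b.
  move=> feas; have := big_sets_card n 6 t SS A t_ge1 deg_le_t; rewrite -/B => cardB.
  have := dual_feasible_card _ _ _ _ _ _ _ _ _ _ x_bound feas; set F := [set _ | _]%SET => cardA.
  have [_ b_ge0 _ _] := feas.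
  (* The constant 6 enters here: tripling [cardA] gives 3|A| <= 6|B| + 6|F| <= |A| + 6|F|. *)
  have cardF : (#|A| <= 3 * #|F|)%N by lia.
  have sumF : #|F|%:R <= dual_objective A b.
    rewrite /dual_objective big_enum_val /= -sum1_card natr_sum big_mkcond /=.
    apply: ler_sum => j _; rewrite inE; case: (leP 1 (b _)) => // _.
    by rewrite b_ge0 ?enum_valP.
  move: cardF; rewrite -(ler_nat R) natrM; lra.
(* A lower bound for every feasible objective is one for the infimum, also when the feasible set is
   empty. *)
split=> //; apply: le_ereal_inf_tmp => _ [b [alpha [beta [betax [feas ->]]]]].
by rewrite lee_fin; apply: bound feas.
Qed.
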